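(* The relation $\simeq_\varepsilon$ ($\varepsilon$-perturbed bisimilarity) is not additive in the tolerances and can distinguish bisimilar LMCs in the following sense: there are finite LMCs $\mathcal{M}_1,\mathcal{M}_2$ and $\mathcal{N}$ such that $\mathcal{M}_1\sim\mathcal{M}_2$ and $\mathcal{M}_1\simeq_\varepsilon\mathcal{N}$, but $\mathcal{M}_2\not\simeq_\varepsilon\mathcal{N}$.
   Context: Throughout, $\varepsilon\in[0,1]$ denotes a tolerance. Fix a countable set $AP$ of atomic propositions. A labeled Markov chain (LMC) $\mathcal{M}=(S,P,s_{init},l)$ has a countable nonempty state set $S$, a transition function $P\colon S\to Distr(S)$ ($Distr(S)$ is the set of probability distributions on $S$), an initial state $s_{init}\in S$ and a labeling $l\colon S\to 2^{AP}$. It is finite if $S$ is finite. For $A\subseteq S$, $P(s)(A)=\sum_{t\in A}P(s)(t)$. The direct sum $\mathcal{M}\oplus\mathcal{N}$ is the LMC on the disjoint union of the state spaces with inherited transitions and labels (its initial state is irrelevant). An equivalence $R\subseteq S\times S$ is a (probabilistic) bisimulation on $\mathcal{M}$ if for all $(s,t)\in R$ and all $R$-equivalence classes $C$: $l(s)=l(t)$ and $P(s)(C)=P(t)(C)$. States are bisimilar, $s\sim t$, if related by some bisimulation; $\mathcal{M}\sim\mathcal{N}$ if $s_{init}^{\mathcal{M}}\sim s_{init}^{\mathcal{N}}$ in $\mathcal{M}\oplus\mathcal{N}$. An $\varepsilon$-perturbation of $\mathcal{M}=(S,P,s_{init},l)$ is an LMC $\mathcal{M}'=(S,P',s_{init},l)$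 with $\|P(s)-P'(s)\|_1=\sum_{t\in S}|P(s)(t)-P'(s)(t)|\le\varepsilon$ for all $s\in S$. An equivalence $R$ on $S$ is an $\varepsilon$-perturbed bisimulation on $\mathcal{M}$ if there is an $\varepsilon$-perturbation $\mathcal{M}'$ of $\mathcal{M}$ such that $R$ is a bisimulation on $\mathcal{M}'$. $s\simeq_\varepsilon t$ if $(s,t)\in R$ for some $\varepsilon$-perturbed bisimulation $R$; $\mathcal{M}\simeq_\varepsilon\mathcal{N}$ if $s_{init}^{\mathcal{M}}\simeq_\varepsilon s_{init}^{\mathcal{N}}$ in $\mathcal{M}\oplus\mathcal{N}$. A family of relations $(\bowtie_\varepsilon)_\varepsilon$ is additive in the tolerances if $x\bowtie_{\varepsilon_1}y$ and $y\bowtie_{\varepsilon_2}z$ always imply $x\bowtie_{\varepsilon'}z$ for some $0\le\varepsilon'\le\min\{1,\varepsilon_1+\varepsilon_2\}$. *)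

(* Defs.v *)
From Corelib Require Export RelationClasses.
From HB Require Import structures.
From mathcomp Require Export all_boot all_order all_algebra.
From mathcomp Require Export all_classical all_reals ereal esum.

Set Implicit Arguments.
Unset Strict Implicit.
Unset Printing Implicit Defensive.

Import Order.TTheory GRing.Theory Num.Theory.

Local Open Scope classical_set_scope.
Local Open Scope ring_scope.

(* [esum] is the supremum of the finite partial sums, which is the usual sum
   here since all the summed families below are nonnegative. *)
Record distr (R : realType) (S : countType) := Distr {
  mass :> S -> R;
  mass_ge0 : forall t, 0 <= mass t;
  mass_sum1 : (\esum_(t in [set: S]) (mass t)%:E = 1)%E }.

Definition prob (R : realType) (S : countType) (mu : distr R S) (A : set S)
    : \bar R :=
  (\esum_(t in A) (mu t)%:E)%E.

Definition l1dist (R : realType) (S : countType) (mu nu : distr R S) : \bar R :=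
  (\esum_(t in [set: S]) `|mu t - nu t|%:E)%E.

Record lmc (R : realType) (AP : countType) := LMC {
  state : countType;
  trans : state -> distr R state;
  init : state;
  label : state -> set AP }.

Definition finite_lmc (R : realType) (AP : countType) (M : lmc R AP) : Prop :=
  finite_set [set: state M].

Lemma esum_inj_supp (R : realType) (S U : countType) (f : S -> U)
    (b : U -> \bar R) :
  injective f -> (forall u, ~ range f u -> b u = 0%E) ->
  (\esum_(u in [set: U]) b u = \esum_(s in [set: S]) b (f s))%E.
Proof.
move=> f_inj b0; rewrite -(@esum_image _ _ _ [set: S] f b); last first.
  by move=> x y _ _ /f_inj.
rewrite [RHS]esum_mkcond; apply: eq_esum => u _.
by case: ifPn => // /negP ru; apply: b0 => r; apply: ru; rewrite inE.
Qed.

Section DirectSum.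
Variables (R : realType) (S T : countType).

Definition inl_mass (mu : distr R S) (x : S + T) : R :=
  if x is inl s then mu s else 0.

Definition inr_mass (nu : distr R T) (x : S + T) : R :=
  if x is inr t then nu t else 0.

Lemma inl_mass_ge0 mu x : 0 <= inl_mass mu x.
Proof. by case: x => //= s; exact: mass_ge0. Qed.

Lemma inr_mass_ge0 nu x : 0 <= inr_mass nu x.
Proof. by case: x => //= t; exact: mass_ge0. Qed.

Lemma inl_mass_sum1 mu :
  (\esum_(x in [set: (S + T)%type]) (inl_mass mu x)%:E = 1)%E.
Proof.
rewrite (@esum_inj_supp _ S _ inl); first exact: (mass_sum1 mu).
  by move=> ? ? [].
by case=> [s|t] //= []; exists s.
Qed.

Lemma inr_mass_sum1 nu :
  (\esum_(x in [set: (S + T)%type]) (inr_mass nu x)%:E = 1)%E.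
Proof.
rewrite (@esum_inj_supp _ T _ inr); first exact: (mass_sum1 nu).
  by move=> ? ? [].
by case=> [s|t] //= []; exists t.
Qed.

Definition inl_distr (mu : distr R S) : distr R (S + T)%type :=
  Distr (inl_mass_ge0 mu) (inl_mass_sum1 mu).

Definition inr_distr (nu : distr R T) : distr R (S + T)%type :=
  Distr (inr_mass_ge0 nu) (inr_mass_sum1 nu).

End DirectSum.

(* The choice of the initial state is irrelevant. *)
Definition direct_sum (R : realType) (AP : countType) (M N : lmc R AP)
    : lmc R AP :=
  @LMC R AP (state M + state N)%type
    (fun x => match x with
              | inl s => inl_distr (state N) (trans s)
              | inr t => inr_distr (state M) (trans t)
              end)
    (inl (init M))
    (fun x => match x with inl s => label s | inr t => label t end).

(* [[set u | E c u]] is the [E]-equivalence class of [c]. *)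
Definition bisimulation (R : realType) (AP : countType) (M : lmc R AP)
    (E : state M -> state M -> Prop) : Prop :=
  Equivalence E /\
  forall s t, E s t ->
    label s = label t /\
    forall c, prob (trans s) [set u | E c u] = prob (trans t) [set u | E c u].

Definition bisimilar_states (R : realType) (AP : countType) (M : lmc R AP)
    (s t : state M) : Prop :=
  exists2 E, bisimulation E & E s t.

Definition bisimilar (R : realType) (AP : countType) (M N : lmc R AP) : Prop :=
  @bisimilar_states R AP (direct_sum M N) (inl (init M)) (inr (init N)).

Definition with_trans (R : realType) (AP : countType) (M : lmc R AP)
    (P' : state M -> distr R (state M)) : lmc R AP :=
  LMC P' (init M) (@label R AP M).

(* The [eps]-perturbations of [M] are the LMCs [with_trans P'] for the [P']
   satisfying this predicate. *)
Definition perturbation (R : realType) (AP : countType) (eps : R)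
    (M : lmc R AP) (P' : state M -> distr R (state M)) : Prop :=
  forall s, (l1dist (trans s) (P' s) <= eps%:E)%E.

Definition perturbed_bisimulation (R : realType) (AP : countType) (eps : R)
    (M : lmc R AP) (E : state M -> state M -> Prop) : Prop :=
  exists2 P', @perturbation R AP eps M P' &
              @bisimulation R AP (with_trans P') E.

Definition perturbed_bisimilar_states (R : realType) (AP : countType) (eps : R)
    (M : lmc R AP) (s t : state M) : Prop :=
  exists2 E, perturbed_bisimulation eps E & E s t.

Definition perturbed_bisimilar (R : realType) (AP : countType) (eps : R)
    (M N : lmc R AP) : Prop :=
  @perturbed_bisimilar_states R AP eps (direct_sum M N)
    (inl (init M)) (inr (init N)).

Definition additive_in_tolerances (R : realType) (X : Type)
    (rel : R -> X -> X -> Prop) : Prop :=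
  forall eps1 eps2 x y z,
    0 <= eps1 <= 1 -> 0 <= eps2 <= 1 ->
    rel eps1 x y -> rel eps2 y z ->
    exists2 eps', 0 <= eps' <= Num.min 1 (eps1 + eps2) & rel eps' x z.

(* Main.v *)
Require Import Defs.
From mathcomp Require Import lra.

(* All chains have a start state moving to one of two middle states, each of
   which loops until it jumps to an absorbing goal, the only labelled state. In
   M1 and M2 both middle states reach the goal with probability 1/2, and M2 uses
   only one of them; in N the probabilities are 3/4 and 1/4. For eps = 1/4 a
   perturbation may move mass 1/8, so M1 and N can meet at 5/8 and 3/8. The only
   reachable middle state of M2, however, would have to be identified with both
   middle states of N, whose perturbed probabilities are at least 5/8 and at
   most 3/8. Bisimilarity being perturbed bisimilarity with tolerance 0, the
   same chains refute additivity. *)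

Set Implicit Arguments.
Unset Strict Implicit.
Unset Printing Implicit Defensive.

Import Order.TTheory GRing.Theory Num.Theory.

Local Open Scope ring_scope.

(** * Probabilities and distances as finite sums *)

Section FiniteDistr.
Local Open Scope classical_set_scope.
Variables (R : realType) (F : finType).
Implicit Types mu nu : distr R F.

Lemma esum_finType (A : set F) (f : F -> R) : (forall x, 0 <= f x) ->
  (\esum_(x in A) (f x)%:E = (\sum_(x | x \in A) f x)%:E)%E.
Proof.
move=> f0; rewrite esum_mkcond esum_fset; first last.
- by move=> x _; case: ifP; rewrite ?lee_fin.
- exact: finite_finset.
rewrite (fsbigE (index_enum F)); first last.
- by move=> x _; rewrite mem_index_enum.
- by move=> x _.
- exact: index_enum_uniq.
rewrite -sumEFin [RHS]big_mkcond; apply: eq_bigl => x.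
by rewrite in_setT.
Qed.

Lemma prob_finType mu (A : set F) : prob mu A = (\sum_(x | x \in A) mu x)%:E.
Proof. by apply: esum_finType => x; exact: mass_ge0. Qed.

Lemma prob_kernel (T : eqType) (f : F -> T) (c : T) mu :
  prob mu [set u | c = f u] = (\sum_(u | c == f u) mu u)%:E.
Proof.
rewrite prob_finType; congr EFin; apply: eq_bigl => u.
by apply/idP/eqP; rewrite inE.
Qed.

Lemma l1dist_finType mu nu : l1dist mu nu = (\sum_x `|mu x - nu x|)%:E.
Proof.
rewrite /l1dist esum_finType//; congr EFin.
by apply: eq_bigl => x; rewrite in_setT.
Qed.

Lemma mass_finType mu : \sum_x mu x = 1.
Proof.
have := mass_sum1 mu; rewrite esum_finType => [[<-]|x]; last exact: mass_ge0.
by apply: eq_bigl => x; rewrite in_setT.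
Qed.

(* Since both masses sum to 1, the excess of [mu] over [nu] on [A] equals its
   deficit on the complement, so each is at most half of the l1 distance. *)
Lemma l1dist_half (eps : R) (mu nu : distr R F) (A : pred F) :
  (l1dist mu nu <= eps%:E)%E ->
  `|\sum_(x | A x) mu x - \sum_(x | A x) nu x| <= eps / 2.
Proof.
rewrite l1dist_finType lee_fin (bigID A) /= => le_eps.
have := mass_finType mu; rewrite (bigID A) /= => mu1.
have := mass_finType nu; rewrite (bigID A) /= => nu1.
have := ler_norm_sum (index_enum F) (fun x => mu x - nu x) A.
have := ler_norm_sum (index_enum F) (fun x => mu x - nu x) (predC A).
rewrite !big_split /= !sumrN.
have -> : \sum_(x | ~~ A x) mu x - \sum_(x | ~~ A x) nu x =
          - (\sum_(x | A x) mu x - \sum_(x | A x) nu x) by lra.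
rewrite normrN; lra.
Qed.

End FiniteDistr.

Lemma kernel_equivalence (S T : Type) (f : S -> T) :
  Equivalence (fun x y => f x = f y).
Proof. by split=> [x|x y|x y z] //= -> //. Qed.

(** * Monotonicity in the tolerance, and additivity *)

Section Perturbation.
Variables (R : realType) (AP : countType).
Implicit Types M N : lmc R AP.

Lemma l1dist_refl (S : countType) (mu : distr R S) : l1dist mu mu = 0%E.
Proof. by apply: esum1 => x _; rewrite subrr normr0. Qed.

Lemma perturbed_bisimilar_le (eps1 eps2 : R) M N : eps1 <= eps2 ->
  perturbed_bisimilar eps1 M N -> perturbed_bisimilar eps2 M N.
Proof.
move=> le12 [E [P' pert bis] EMN]; exists E => //; exists P' => // s.
by apply: (le_trans (pert s)); rewrite lee_fin.
Qed.

Lemma bisimilar_perturbed0 M N : bisimilar M N -> perturbed_bisimilar 0 M N.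
Proof.
move=> [E bis EMN]; exists E => //.
by exists (@trans R AP (direct_sum M N)) => // s; rewrite l1dist_refl.
Qed.

(** Additivity along [M2], [M1], [N] with tolerances 0 and [eps] would relate [M2] to [N] at some
    tolerance at most [eps], hence at [eps] by monotonicity. *)
Lemma not_additive_of_bisimilar (eps : R) M1 M2 N : 0 <= eps <= 1 ->
  bisimilar M2 M1 -> perturbed_bisimilar eps M1 N ->
  ~ perturbed_bisimilar eps M2 N ->
  ~ additive_in_tolerances (@perturbed_bisimilar R AP).
Proof.
move=> eps01 /bisimilar_perturbed0 M21 M1N M2N add.
have [||eps' /andP[_]] := add 0 eps M2 M1 N _ _ M21 M1N; rewrite ?lexx ?ler01//.
by rewrite add0r le_min => /andP[_ /perturbed_bisimilar_le le] /le.
Qed.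

End Perturbation.

(** * The four-state chains *)

Section Chain.
Variables (R : realType) (AP : countType).

Definition node : finType := (bool + bool)%type.
Definition start : node := inl false.
Definition goal : node := inl true.
Definition mid (b : bool) : node := inr b.

(** [wt] is the probability of moving from [start] to [mid true], and [hit b] that of jumping from
    [mid b] to [goal]. *)
Record weights := Weights {
  wt : R;
  hit : bool -> R;
  wt01 : 0 <= wt <= 1;
  hit01 : forall b, 0 <= hit b <= 1 }.

Definition chain_mass (w : weights) (x y : node) : R :=
  match x, y with
  | inl false, inr b => if b then wt w else 1 - wt w
  | inl true, inl true => 1
  | inr b, inl true => hit w b
  | inr b, inr c => if b == c then 1 - hit w b else 0
  | _, _ => 0
  end.

Lemma chain_mass_ge0 w x y : 0 <= chain_mass w x y.
Proof.
have := wt01 w; have := hit01 w true; have := hit01 w false.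
by case: x => [[]|[]]; case: y => [[]|[]] //=; lra.
Qed.

Lemma chain_mass_sum1 w x :
  (\esum_(y in [set: node]) (chain_mass w x y)%:E = 1)%E.
Proof.
rewrite esum_finType; last exact: chain_mass_ge0.
congr EFin; under eq_bigl do rewrite in_setT.
by rewrite big_sumType !big_bool; case: x => [[]|[]] /=; lra.
Qed.

Definition chain (w : weights) : lmc R AP :=
  @LMC R AP node (fun x => Distr (chain_mass_ge0 w x) (chain_mass_sum1 w x))
    start (fun x => if x is inl true then setT else set0)%classic.

Lemma chain_finite w : finite_lmc (chain w).
Proof. exact: finite_finset. Qed.

Lemma hit_half01 (b : bool) : 0 <= (1 / 2 : R) <= 1.
Proof. lra. Qed.

Definition half_hit w (w01 : 0 <= w <= 1) := Weights w01 hit_half01.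

Lemma chain_bisimilar w w' (w01 : 0 <= w <= 1) (w'01 : 0 <= w' <= 1) :
  bisimilar (chain (half_hit w01)) (chain (half_hit w'01)).
Proof.
(* All middle states have the same law up to merging them, so they form one class; [start] then
   enters it with probability 1 whatever the weight. *)
pose cls (x : node) := if x is inl b then Some b else None.
pose f (x : node + node) := match x with inl y => cls y | inr y => cls y end.
exists (fun x y => f x = f y) => //; split; first exact: kernel_equivalence.
move=> x y fxy; split.
  by case: x fxy => [] [[]|[]]; case: y => [] [[]|[]].
move=> c; rewrite !(@prob_kernel R (node + node)%type).
congr EFin; rewrite ![LHS]big_mkcond ![RHS]big_mkcond /=.
rewrite !big_sumType !big_bool /=.
case: (f c) => [[]|]; case: x fxy => [] [[]|[]];
  case: y => [] [[]|[]] //= _; lra.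
Qed.

(** Both chains are perturbed to the same chain [w]; folding its two copies onto each other is then
    a bisimulation. *)
Lemma chain_perturbed_bisimilar (eps : R) (u v w : weights) :
  wt u = wt w -> wt v = wt w ->
  (forall b, `|hit u b - hit w b| <= eps / 2) ->
  (forall b, `|hit v b - hit w b| <= eps / 2) ->
  perturbed_bisimilar eps (chain u) (chain v).
Proof.
move=> uw vw hu hv.
pose f (x : node + node) := match x with inl y => y | inr y => y end.
exists (fun x y => f x = f y) => //.
exists (@trans R AP (direct_sum (chain w) (chain w))).
  move=> x; rewrite (@l1dist_finType R (node + node)%type) lee_fin.
  (* A middle row changes in two entries, the jump and the loop, by opposite amounts of size at most
     [eps / 2]. *)
  have swap (a b : R) : 1 - a - (1 - b) = - (a - b) by lra.
  have eps0 : 0 <= eps by have := le_trans (normr_ge0 _) (hu true); lra.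
  rewrite !big_sumType !big_bool /=.
  case: x => [] [[]|b] /=; rewrite ?uw ?vw ?subrr ?normr0 ?addr0 ?add0r //.
  - have := hu b.
    by case: b => /=; rewrite subrr normr0 swap normrN; lra.
  - have := hv b.
    by case: b => /=; rewrite subrr normr0 swap normrN; lra.
split; first exact: kernel_equivalence.
move=> x y fxy; split; first by case: x fxy => x /=; case: y => y /= ->.
move=> c; rewrite !(@prob_kernel R (node + node)%type).
congr EFin; rewrite ![LHS]big_mkcond ![RHS]big_mkcond /=.
rewrite !big_sumType !big_bool /=.
by case: x fxy => x /=; case: y => y /= ->; lra.
Qed.

Lemma chain_not_perturbed_bisimilar (eps : R) (u v : weights) : inhabited AP ->
  wt u = 1 -> wt v = 1 / 2 -> eps < 1 / 2 ->
  eps < `|hit v true - hit v false| ->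
  ~ perturbed_bisimilar eps (chain u) (chain v).
Proof.
move=> [ap] u1 v2 eps2 epsv [E [P' pert [eqE bis]] Est].
pose tr := @trans R AP (direct_sum (chain u) (chain v)).
have close (x : node + node) (A : set (node + node)) :
    `|\sum_(y in A) tr x y - \sum_(y in A) P' x y| <= eps / 2.
  exact: (@l1dist_half R (node + node)%type _ (tr x) (P' x) (mem A) (pert x)).
have same (x y c : node + node) : E x y ->
    let A := [set z : node + node | E c z]%classic in
    \sum_(z in A) P' x z = \sum_(z in A) P' y z.
  by move=> /bis[_ /(_ c)]; rewrite !(@prob_finType R (node + node)%type) => -[].
(* From [start], the class of [mid true] in [u] has perturbed mass at least [1 - eps / 2]. If it
   missed [mid b] of [v], its mass from the other start would be at most [1 / 2 + eps / 2], forcing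
   [eps >= 1 / 2]. *)
have mid_class b : E (inl (mid true)) (inr (mid b)).
  apply: contrapT => nE.
  pose A := [set z : node + node | E (inl (mid true)) z]%classic.
  have Au : inl (mid true) \in A by rewrite inE /A /=; reflexivity.
  have Av : (inr (mid b) \in A) = false by apply/negP; rewrite inE.
  have := close (inl start) A; have := close (inr start) A.
  rewrite (same _ _ (inl (mid true)) Est) -/A.
  move: (\sum_(z | _) P' _ _) => q.
  rewrite !(big_mkcond (fun z => z \in A)) /= !big_sumType !big_bool /=.
  rewrite Au !ler_norml.
  case: b Av {nE} => ->; rewrite ?if_same u1 v2;
    case: ifP => _; case: ifP => _; lra.
pose A := [set z : node + node | E (inr goal) z]%classic.
have Emid : E (inr (mid true)) (inr (mid false)).
  case: eqE => _ symE transE.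
  exact: transE (symE _ _ (mid_class true)) (mid_class false).
have goalA : inr goal \in A by rewrite inE; case: eqE => reflE _ _; exact: reflE.
(* The labels [setT] and [set0] differ at [ap], so the class of [goal] contains no middle state of
   [v], and its unperturbed mass from [mid b] is exactly [hit v b]. *)
have midA b : (inr (mid b) \in A) = false.
  apply/negP; rewrite inE => /bis[/= L _].
  by have : (set0 : set AP) ap by rewrite -L.
have := close (inr (mid true)) A; have := close (inr (mid false)) A.
rewrite (same _ _ (inr goal) Emid) -/A.
(* Both hitting probabilities lie within [eps / 2] of the common value [q]. *)
move: (\sum_(z | _) P' _ _) => q.
rewrite !(big_mkcond (fun z => z \in A)) /= !big_sumType !big_bool /=.
rewrite goalA !midA !if_same !ler_norml => /andP[q1 q2] /andP[q3 q4].
suff : `|hit v true - hit v false| <= eps by rewrite leNgt epsv.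
by rewrite ler_norml; lra.
Qed.

End Chain.

Theorem proposition4p4 (R : realType) (AP : countType) (AP_nonempty : inhabited AP) :
  ~ additive_in_tolerances (@perturbed_bisimilar R AP) /\
  exists eps : R, 0 <= eps <= 1 /\
    exists M1 M2 N : lmc R AP,
      [/\ finite_lmc M1, finite_lmc M2 & finite_lmc N] /\
      [/\ bisimilar M1 M2,
          perturbed_bisimilar eps M1 N
        & ~ perturbed_bisimilar eps M2 N].
Proof.
have half : 0 <= (1 / 2 : R) <= 1 by lra.
have one : 0 <= (1 : R) <= 1 by lra.
have hN (b : bool) : 0 <= (if b then 3 / 4 else 1 / 4 : R) <= 1 by case: b; lra.
(* The midpoints of 1/2 with 3/4 and with 1/4. *)
have hQ (b : bool) : 0 <= (if b then 5 / 8 else 3 / 8 : R) <= 1 by case: b; lra.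
pose M1 := chain AP (half_hit half); pose M2 := chain AP (half_hit one).
pose N := chain AP (Weights half hN).
have M1N : perturbed_bisimilar (1 / 4) M1 N.
  by apply: (@chain_perturbed_bisimilar _ _ _ _ _ (Weights half hQ)) => //= -[];
    rewrite ler_norml; lra.
have M2N : ~ perturbed_bisimilar (1 / 4) M2 N.
  apply: chain_not_perturbed_bisimilar => //=; first by lra.
  by rewrite ger0_norm; lra.
split.
  apply: not_additive_of_bisimilar M1N M2N; first by lra.
  exact: chain_bisimilar.
exists (1 / 4); split; first by lra.
exists M1, M2, N; split; split => //; try exact: chain_finite.
exact: chain_bisimilar.
Qed.
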